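(* Let $k$ be a field, let $G=(V,E,s,t)$ be a quiver, and let $D$ be a prime subcoalgebra of the path coalgebra $PC(G)$. For any path $q\in P(D)$ and any positive integer $n$, there exists a cycle $c\in P(D)$ such that $q\prec^n c$.
   Context: A quiver $G=(V,E,s,t)$ consists of sets $V$ (vertices) and $E$ (arrows) and maps $s,t:E\to V$ (source and tail). A path is a finite sequence of arrows $p=x_1\cdots x_n$ with $t(x_i)=s(x_{i+1})$ for $i=1,\dots,n-1$; $s(p)=s(x_1)$, $t(p)=t(x_n)$, and the length of $p$ is the number of arrows composing it. Vertices are considered as trivial paths, of length $0$, with $s(a)=t(a)=a$; concatenation with a trivial path at the appropriate end leaves a path unchanged. A cycle is a path of length $\geq 1$ whose source and tail coincide. The path coalgebra $PC(G)$ is the $k$-vector space with basis the set of all paths, with $\Delta(p)=\sum_{p_1p_2=p}p_1\otimes p_2$ (sum over all ways of writing $p$ as a concatenation, so $\Delta(a)=a\otimes a$ for a vertex $a$), $\varepsilon(a)=1$ for vertices $a$ and $\varepsilon(p)=0$ for paths of positive length. For subcoalgebras $A,B$ of a coalgebra $C$, the wedge product is $A\wedge^C B=\Delta^{-1}(C\otimes B+A\otimes C)$. A coalgebra $C$ is prime if for any subcoalgebras $A,B$ of $C$ with $C=A\wedge^C B$, either $C=A$ or $C=B$. A prime subcoalgebra is a subcoalgebra that is prime as a coalgebra. For a subcoalgebra $D\subseteq PC(G)$, $P(D)$ is the set of all paths that appear with nonzero coefficient in (the path-basis expansion of) some element of $D$. For paths $p,q$ and $n\geq1$, $q\prec^n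 p$ means that there exist paths $p_1,\dots,p_{n+1}$ (possibly trivial) such that $p$ is the concatenation $p_1qp_2q\cdots p_nqp_{n+1}$.
   Formalization: The formal theorem additionally assumes that D is not the one-dimensional subcoalgebra ka spanned by a vertex a: ka is prime with P(D)={a}, which contains no cycle (cycles have length at least 1), so the claim fails exactly there. *)

(* Defs.v *)
From HB Require Import structures.
From mathcomp Require Import all_boot all_order all_algebra.
From mathcomp Require Import finmap.
From mathcomp.multinomials Require Import monalg.

Set Implicit Arguments.
Unset Strict Implicit.
Unset Printing Implicit Defensive.

Import GRing.Theory.
Local Open Scope ring_scope.

Record quiver := Quiver {
  vertex : choiceType;
  arrow : choiceType;
  asrc : arrow -> vertex;
  atgt : arrow -> vertex
}.

Section Paths.
Variable G : quiver.

Fixpoint walk (v : vertex G) (xs : seq (arrow G)) : bool :=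
  if xs is x :: xs' then (asrc x == v) && walk (atgt x) xs' else true.

Definition walk_end (v : vertex G) (xs : seq (arrow G)) : vertex G :=
  last v (map (@atgt G) xs).

(* A path is kept as its source together with its arrows, so that the trivial
   path at [a] is [(a, [::])]; when there is at least one arrow the source is
   forced to be that of the first arrow. *)
Record gpath := GPath {
  pval : vertex G * seq (arrow G);
  pvalP : walk pval.1 pval.2
}.
HB.instance Definition _ := [isSub for pval].
(* Opaque: unfolding this structure makes failed conversions in [{malg _}]
   blow up. *)
Fact gpath_choice : Choice gpath.
Proof. exact: (Choice.class (sub_type gpath)). Qed.
HB.instance Definition _ := gpath_choice.

Definition psrc (p : gpath) : vertex G := (pval p).1.
Definition parrows (p : gpath) : seq (arrow G) := (pval p).2.
Definition ptgt (p : gpath) : vertex G := walk_end (psrc p) (parrows p).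
Definition plen (p : gpath) : nat := size (parrows p).

Definition ptriv (a : vertex G) : gpath := @GPath (a, [::]) isT.

Definition is_cycle (p : gpath) : Prop := (1 <= plen p)%N /\ psrc p = ptgt p.

Definition is_concat (p1 p2 p : gpath) : Prop :=
  [/\ ptgt p1 = psrc p2, psrc p = psrc p1 & parrows p = parrows p1 ++ parrows p2].

Fixpoint is_concats (p1 : gpath) (ps : seq gpath) (p : gpath) : Prop :=
  if ps is p2 :: ps' then exists r, is_concats p2 ps' r /\ is_concat p1 r p
  else p = p1.

(* [q ≺^n p]: the tuple [ps] holds p_2, ..., p_{n+1}, and the list handed to
   [is_concats] is q, p_2, q, p_3, ..., q, p_{n+1}. *)
Definition prec (q : gpath) (n : nat) (p : gpath) : Prop :=
  exists (p1 : gpath) (ps : n.-tuple gpath),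
    is_concats p1 (flatten [seq [:: q; r] | r <- ps]) p.

Lemma walk_cat v xs ys :
  walk v (xs ++ ys) = walk v xs && walk (walk_end v xs) ys.
Proof. by elim: xs v => //= x xs IH v; rewrite IH andbA. Qed.

Lemma walk_take i (p : gpath) : walk (psrc p) (take i (parrows p)).
Proof.
case: p => -[v xs] /= H; rewrite /psrc /parrows /=.
by move: H; rewrite -{1}(cat_take_drop i xs) walk_cat => /andP[].
Qed.

Lemma walk_drop i (p : gpath) :
  walk (walk_end (psrc p) (take i (parrows p))) (drop i (parrows p)).
Proof.
case: p => -[v xs] /= H; rewrite /psrc /parrows /=.
by move: H; rewrite -{1}(cat_take_drop i xs) walk_cat => /andP[].
Qed.

Definition ptake i (p : gpath) : gpath :=
  @GPath (psrc p, take i (parrows p)) (walk_take i p).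

Definition pdrop i (p : gpath) : gpath :=
  @GPath (walk_end (psrc p) (take i (parrows p)), drop i (parrows p))
    (walk_drop i p).

Definition splits (p : gpath) : seq (gpath * gpath) :=
  [seq (ptake i p, pdrop i p) | i <- iota 0 (plen p).+1].

Lemma splitsP (p1 p2 p : gpath) :
  reflect (is_concat p1 p2 p) ((p1, p2) \in splits p).
Proof.
apply: (iffP mapP) => [[i _ [-> ->]]|].
  by split=> //; rewrite /parrows /= cat_take_drop.
case: p1 p2 p => [[v1 xs1] w1] [[v2 xs2] w2] [[v xs] w] [].
rewrite /ptgt /psrc /parrows /= => Ev2 Ev Exs; subst.
exists (size xs1).
  by rewrite (mem_iota 0 _.+1) ltnS /plen /parrows /= size_cat leq_addr.
by congr pair; apply: val_inj;
  rewrite /= /psrc /parrows /= ?take_size_cat ?drop_size_cat.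
Qed.

Lemma splits_uniq (p : gpath) : uniq (splits p).
Proof.
rewrite map_inj_in_uniq ?iota_uniq // => i j; rewrite !(mem_iota 0 _.+1) !ltnS /=.
by move=> le_i le_j [] /(congr1 size); rewrite !size_takel.
Qed.

End Paths.

(* A vector space with a chosen basis [X] is [{malg k[X]}], the finitely
   supported functions X -> k; its tensor square is then [{malg k[X * X]}],
   the basis vector (p, q) standing for p ⊗ q. *)
Section Coalgebra.
Variables (k : fieldType) (X : choiceType).
Variable comul : {malg k[X]} -> {malg k[(X * X)%type]}.
Local Notation C := {malg k[X]}.
Local Notation CC := {malg k[(X * X)%type]}.
Implicit Types A B D : C -> Prop.

Definition tens (u v : C) : CC :=
  \sum_(p <- msupp u) \sum_(q <- msupp v) << u@_p * v@_q *g (p, q) >>.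

Definition same A B : Prop := forall x, A x <-> B x.
Definition sub A B : Prop := forall x, A x -> B x.

Definition subspace A : Prop :=
  A 0 /\ forall (c : k) x y, A x -> A y -> A (c *: x + y).

(* The image of A ⊗ B in C ⊗ C. *)
Definition tens_sub A B (z : CC) : Prop :=
  exists s : seq (C * C),
    (forall ab, ab \in s -> A ab.1 /\ B ab.2) /\
    z = \sum_(ab <- s) tens ab.1 ab.2.

Definition subcoalgebra A : Prop :=
  subspace A /\ forall x, A x -> tens_sub A A (comul x).

(* The wedge A ∧^D B computed in the coalgebra D, itself a subcoalgebra of the
   ambient C: over a field D ⊗ D embeds in C ⊗ C. *)
Definition wedge D A B (x : C) : Prop :=
  D x /\ exists z1 z2 : CC,
    [/\ tens_sub D B z1, tens_sub A D z2 & comul x = z1 + z2].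

Definition prime_subcoalgebra D : Prop :=
  subcoalgebra D /\
  forall A B, subcoalgebra A -> sub A D -> subcoalgebra B -> sub B D ->
    same D (wedge D A B) -> same D A \/ same D B.

End Coalgebra.

Section PathCoalgebra.
Variables (k : fieldType) (G : quiver).

Definition path_comul (x : {malg k[gpath G]}) :
  {malg k[(gpath G * gpath G)%type]} :=
  \sum_(p <- msupp x) x@_p *: \sum_(pq <- splits p) << pq >>.

Definition path_support (D : {malg k[gpath G]} -> Prop) (p : gpath G) : Prop :=
  exists2 d, D d & d@_p != 0.

(* The one-dimensional subcoalgebra k a.  It is prime, but its support is {a},
   which contains no cycle of positive length. *)
Definition vertex_line (a : vertex G) (x : {malg k[gpath G]}) : Prop :=
  exists c : k, x = c *: << ptriv a >>.

End PathCoalgebra.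

(* Main.v *)
(* If no path in the support of D traversed q and later q', then D would be the
   wedge of the two subcoalgebras formed by the elements of D whose paths avoid
   q, respectively q'; both are proper, contradicting primality.  Hence any two
   paths q, q' of P(D), which is closed under subpaths, are joined by some
   q m q' in P(D).  In particular P(D) contains a path s of positive length
   through q, unless D is the line spanned by a vertex.  Joining n + 1 copies of
   s gives s m_1 s ... m_n s, and dropping the last s leaves the cycle. *)
Require Import Defs.
From Stdlib Require Import Classical.
From HB Require Import structures.
From mathcomp Require Import all_boot all_order all_algebra.
From mathcomp Require Import finmap.
From mathcomp.multinomials Require Import monalg.

(** * Tensors whose coefficients vanish on a product of sets of basis vectors *)

Section TensorSupports.
Set Implicit Arguments.
Unset Strict Implicit.
Unset Printing Implicit Defensive.
Import GRing.Theory.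
Local Open Scope ring_scope.
Variables (k : fieldType) (X : choiceType).
Local Notation C := {malg k[X]}.
Local Notation CC := {malg k[(X * X)%type]}.
Implicit Types (A B : C -> Prop) (T : X -> Prop).

Lemma sum_msupp (g : C) (p : X) (F : X -> k) :
  \sum_(q <- msupp g) (g@_q * F q) *+ (q == p) = g@_p * F p.
Proof.
have [gp|gp] := boolP (p \in msupp g); last first.
  rewrite (mcoeff_outdom gp) mul0r big1_seq // => q /andP[_ gq].
  by case: eqP => // qp; rewrite -qp gq in gp.
rewrite (big_fsetD1 p) //= eqxx mulr1n big1_seq ?addr0 // => q /andP[_].
by rewrite !inE => /andP[/negPf->].
Qed.

Lemma mcoeff_tens (u v : C) p r : (tens u v)@_(p, r) = u@_p * v@_r.
Proof.
rewrite /tens raddf_sum -(sum_msupp u p (fun=> v@_r)); apply: eq_bigr => p' _.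
rewrite raddf_sum /= -[v@_r]mulr1 -(sum_msupp v r (fun=> 1)).
rewrite mulr_sumr -sumrMnl; apply: eq_bigr => r' _.
by rewrite mcoeffU xpair_eqE mulr1; case: (_ == p); case: (_ == r);
  rewrite ?mulr0.
Qed.

Lemma mcoeff_sum_tens (I : Type) (s : seq I) (a b : I -> C) p r :
  (\sum_(i <- s) tens (a i) (b i))@_(p, r) = \sum_(i <- s) (a i)@_p * (b i)@_r.
Proof. by rewrite raddf_sum; apply: eq_bigr => i _; apply: mcoeff_tens. Qed.

Lemma subspaceD A x y : subspace A -> A x -> A y -> A (x + y).
Proof. by move=> [_ h] Ax Ay; rewrite -[x]scale1r; apply: h. Qed.

Lemma subspaceZ A c x : subspace A -> A x -> A (c *: x).
Proof. by move=> [h0 h] Ax; rewrite -[_ *: _]addr0; apply: h. Qed.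

Lemma subspace_sum A (I : Type) (s : seq I) (F : I -> C) :
  subspace A -> (forall i, A (F i)) -> A (\sum_(i <- s) F i).
Proof.
move=> sA AF; elim/big_ind: _ => [|x y|i _]; last exact: AF.
  by case: sA.
exact: subspaceD.
Qed.

Lemma tens_subD A B z1 z2 :
  tens_sub A B z1 -> tens_sub A B z2 -> tens_sub A B (z1 + z2).
Proof.
move=> [s1 [h1 ->]] [s2 [h2 ->]]; exists (s1 ++ s2); split;
  last by rewrite big_cat.
by move=> ab; rewrite mem_cat => /orP[/h1|/h2].
Qed.

Lemma tens_sub0 A B : tens_sub A B 0.
Proof. by exists [::]; split=> //; rewrite big_nil. Qed.

Lemma tens_sub_tens A B a b : A a -> B b -> tens_sub A B (tens a b).
Proof.
move=> Aa Bb; exists [:: (a, b)]; split; last by rewrite big_seq1.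
by move=> ab; rewrite inE => /eqP->.
Qed.

(** [T := subpath q] gives the elements whose paths all avoid [q]; [T := fun=> True] forces
    [x = 0]. *)
Definition vanishing_on A T (x : C) : Prop := A x /\ forall p, T p -> x@_p = 0.

Lemma subspace_vanishing_on A T : subspace A -> subspace (vanishing_on A T).
Proof.
move=> [A0 A1]; split; first by split=> // p _; rewrite mcoeff0.
move=> c x y [Ax x0] [Ay y0]; split; first exact: A1.
by move=> p Tp; rewrite mcoeffD mcoeffZ x0 // y0 // mulr0 addr0.
Qed.

(* If the [a i] are linearly independent as functions on [T1], every [b i]
   vanishes on [T2]; otherwise a dependence relation produces an element of
   [vanishing_on A T1] and a presentation with one term less. *)
Lemma sum_tens_split A B T1 T2 : subspace A -> subspace B ->
  forall n (a b : 'I_n -> C), (forall i, A (a i)) -> (forall i, B (b i)) ->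
  (forall p r, T1 p -> T2 r -> \sum_i (a i)@_p * (b i)@_r = 0) ->
  exists z1 z2, [/\ tens_sub (vanishing_on A T1) B z1,
    tens_sub A (vanishing_on B T2) z2 & \sum_i tens (a i) (b i) = z1 + z2].
Proof.
move=> sA sB; elim=> [|n IH] a b Aa Bb ab0.
  by exists 0, 0; split; rewrite ?big_ord0 ?addr0 //; apply: tens_sub0.
have [[c [j cj c0]]|indep] := classic (exists c : 'I_n.+1 -> k,
    exists2 j, c j != 0 & forall p, T1 p -> \sum_i c i * (a i)@_p = 0).
  pose a' := \sum_i c i *: a i.
  have a'E p : a'@_p = \sum_i c i * (a i)@_p.
    by rewrite raddf_sum; apply: eq_bigr => i _; rewrite /= mcoeffZ.
  have A'a' : vanishing_on A T1 a'.
    split; first by apply: subspace_sum => // i; apply: subspaceZ.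
    by move=> p Tp; rewrite a'E c0.
  (* Replacing [a j] by a combination of [a'] and the other [a i] leaves one term [a'] ⊗
     [(c j)^-1 *: b j] and [n] terms with the corrected factors [b']. *)
  pose b' i := b (lift j i) - (c (lift j i) / c j) *: b j.
  have E p r : \sum_i (a i)@_p * (b i)@_r = a'@_p * ((c j)^-1 * (b j)@_r) +
      \sum_i (a (lift j i))@_p * (b' i)@_r.
    rewrite a'E mulr_suml !(bigD1_ord j) //= -addrA -big_split /=; congr (_ + _).
      by rewrite mulrACA mulfV // mul1r.
    apply: eq_bigr => i _; rewrite mcoeffB mcoeffZ mulrBr addrCA.
    by rewrite [c _ * _]mulrC -!mulrA subrr addr0.
  have [//|i||z1 [z2 [h1 h2 h]]] := IH (fun i => a (lift j i)) b'.
  - by apply: subspaceD => //; rewrite -scaleNr; apply: subspaceZ.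
  - move=> p r Tp Tr; rewrite -[RHS](ab0 p r) // E.
    by case: A'a' => _ /(_ p Tp) ->; rewrite mul0r add0r.
  exists (tens a' ((c j)^-1 *: b j) + z1), z2; split=> //.
    by apply: tens_subD => //; apply: tens_sub_tens => //; apply: subspaceZ.
  rewrite -addrA -h; apply/malgP => -[p r].
  by rewrite mcoeffD !mcoeff_sum_tens mcoeff_tens mcoeffZ E.
exists 0, (\sum_i tens (a i) (b i)); split; first exact: tens_sub0.
  elim/big_ind: _ => [|x y|i _]; [exact: tens_sub0|exact: tens_subD|].
  apply: tens_sub_tens => //; split=> // r Tr; apply/eqP/negPn/negP => bi.
  (* A nonzero coefficient at [r] would turn the coefficients of the [b i] at [r] into a dependence
     relation on [T1]. *)
  apply: indep; exists (fun i => (b i)@_r), i => // p Tp.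
  by rewrite -[RHS](ab0 p r) //; apply: eq_bigr => i' _; rewrite mulrC.
by rewrite add0r.
Qed.

(** Kernel of a tensor product of linear maps: restricting coefficients to [T1] and to [T2] has
    kernels A' and B', so that of the product is A' ⊗ B + A ⊗ B'. *)
Lemma tens_sub_split A B T1 T2 z : subspace A -> subspace B ->
  tens_sub A B z -> (forall p r, T1 p -> T2 r -> z@_(p, r) = 0) ->
  exists z1 z2, [/\ tens_sub (vanishing_on A T1) B z1,
    tens_sub A (vanishing_on B T2) z2 & z = z1 + z2].
Proof.
move=> sA sB [s [sAB ->]] z0; rewrite big_tnth.
have sABi i := sAB _ (mem_tnth i (in_tuple s)).
apply: sum_tens_split => // [i|i|p r Tp Tr]; try by case: (sABi i).
by have := z0 p r Tp Tr; rewrite mcoeff_sum_tens big_tnth.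
Qed.

Lemma tens_sub_eq0 A B z : tens_sub A B z ->
  (forall a b, A a -> B b -> forall p r, a@_p * b@_r = 0) -> z = 0.
Proof.
move=> [s [h ->]] ab0; rewrite big1_seq // => ab /andP[_ /h[Aa Bb]].
by apply/malgP=> -[p r]; rewrite mcoeff_tens mcoeff0 ab0.
Qed.

(** Two splittings, one per factor: with [fun=> True] on the other side, one of the two summands has
    a zero factor and drops out. *)
Lemma tens_sub_vanishing A T z : subspace A -> tens_sub A A z ->
  (forall p r, T p \/ T r -> z@_(p, r) = 0) ->
  tens_sub (vanishing_on A T) (vanishing_on A T) z.
Proof.
move=> sA Az z0.
have [p r Tp _|z1 [z2 [h1 h2 h]]] :=
  @tens_sub_split A A T (fun=> True) z sA sA Az; first by apply: z0; left.
have {h2} z20 : z2 = 0.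
  by apply: (tens_sub_eq0 h2) => a b _ [_ b0] p r; rewrite b0 ?mulr0.
rewrite {}z20 addr0 in h; rewrite -{}h in h1.
have sAT := @subspace_vanishing_on A T sA.
have [p r _ Tr|w1 [w2 [h2 h3 h]]] :=
  @tens_sub_split _ A (fun=> True) T z sAT sA h1; first by apply: z0; right.
have w10 : w1 = 0.
  by apply: (tens_sub_eq0 h2) => a b [_ a0] _ p r; rewrite a0 ?mul0r.
by rewrite h w10 add0r.
Qed.

(** Applying the coordinate functional of [p] to the left factor sends A ⊗ B into B. *)
Lemma tens_sub_slicel A B z p : subspace B -> tens_sub A B z ->
  exists2 b, B b & forall r, b@_r = z@_(p, r).
Proof.
move=> sB [s [h ->]]; exists (\sum_(ab <- s) ab.1@_p *: ab.2).
  by rewrite big_seq; elim/big_ind: _ => [|x y|ab /h[_ ?]];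
    [case: sB|exact: subspaceD|exact: subspaceZ].
by move=> r; rewrite !raddf_sum; apply: eq_bigr => ab _;
  rewrite /= mcoeffZ mcoeff_tens.
Qed.

Lemma tens_sub_slicer A B z r : subspace A -> tens_sub A B z ->
  exists2 a, A a & forall p, a@_p = z@_(p, r).
Proof.
move=> sA [s [h ->]]; exists (\sum_(ab <- s) ab.2@_r *: ab.1).
  by rewrite big_seq; elim/big_ind: _ => [|x y|ab /h[? _]];
    [case: sA|exact: subspaceD|exact: subspaceZ].
move=> p; rewrite !raddf_sum; apply: eq_bigr => ab _.
by rewrite /= mcoeffZ mcoeff_tens mulrC.
Qed.

End TensorSupports.

Section PrimePathSubcoalgebras.
Set Implicit Arguments.
Unset Strict Implicit.
Unset Printing Implicit Defensive.
Import GRing.Theory.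
Local Open Scope ring_scope.
Variables (k : fieldType) (G : quiver).
Local Notation path := (gpath G).
Local Notation C := {malg k[path]}.
Implicit Types (p q r s t u v w : path) (x y d : C) (D : C -> Prop).

(** * Concatenation and subpaths *)

Lemma walk_end_cat (a : vertex G) xs ys :
  walk_end a (xs ++ ys) = walk_end (walk_end a xs) ys.
Proof. by rewrite /walk_end map_cat last_cat. Qed.

Lemma gpath_inj p q : psrc p = psrc q -> parrows p = parrows q -> p = q.
Proof.
by case: p q => [[a xs] Hp] [[b ys] Hq] /= ab xy; apply: val_inj; congr pair.
Qed.

Lemma is_concat_inj p q r r' : is_concat p q r -> is_concat p q r' -> r = r'.
Proof. by move=> [_ s1 a1] [_ s2 a2]; apply: gpath_inj; rewrite ?s1 ?a1. Qed.

Lemma concat_exists p q : ptgt p = psrc q -> exists r, is_concat p q r.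
Proof.
move=> pq; have w : walk (psrc p) (parrows p ++ parrows q).
  rewrite walk_cat -/(ptgt p) pq.
  by apply/andP; split; [exact: (pvalP p)|exact: (pvalP q)].
by exists (@GPath G (psrc p, parrows p ++ parrows q) w).
Qed.

Lemma concat_src p q r : is_concat p q r -> psrc r = psrc p.
Proof. by case. Qed.

Lemma concat_tgt p q r : is_concat p q r -> ptgt r = ptgt q.
Proof.
by move=> [pq rp E]; rewrite /ptgt rp E walk_end_cat -/(ptgt p) pq.
Qed.

Lemma concat_match p q r : is_concat p q r -> ptgt p = psrc q.
Proof. by case. Qed.

(** Since concatenation is a relation, associativity must also produce the regrouped path. *)
Lemma concatA_r p q r s t : is_concat p q r -> is_concat r s t ->
  exists2 u, is_concat q s u & is_concat p u t.
Proof.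
move=> pqr rst; have [u qsu] : exists u, is_concat q s u.
  by apply: concat_exists; rewrite -(concat_tgt pqr) (concat_match rst).
exists u => //; case: pqr rst qsu => pq rp r_E [rs tr t_E] [qs uq u_E].
by split; rewrite ?uq ?tr // t_E r_E u_E catA.
Qed.

Lemma concatA_l q s u p t : is_concat q s u -> is_concat p u t ->
  exists2 r, is_concat p q r & is_concat r s t.
Proof.
move=> qsu put; have [r pqr] : exists r, is_concat p q r.
  by apply: concat_exists; rewrite -(concat_src qsu) (concat_match put).
exists r => //; have rq := concat_tgt pqr.
case: pqr qsu put => pq rp r_E [qs uq u_E] [pu tp t_E].
by split; rewrite ?rq ?tp // t_E r_E u_E catA.
Qed.

Lemma concat_trivl p : is_concat (ptriv (psrc p)) p p.
Proof. by []. Qed.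

Lemma concat_trivr p : is_concat p (ptriv (ptgt p)) p.
Proof. by split; rewrite //= cats0. Qed.

(** Up to associativity, this is [q ≺^1 p]. *)
Definition subpath q p : Prop :=
  exists u w v, is_concat u q w /\ is_concat w v p.

Lemma subpath_refl q : subpath q q.
Proof.
exists (ptriv (psrc q)), q, (ptriv (ptgt q)); split; first exact: concat_trivl.
exact: concat_trivr.
Qed.

Lemma subpath_concatl q p1 p2 p :
  is_concat p1 p2 p -> subpath q p1 -> subpath q p.
Proof.
move=> h [u [w [v [uqw wvp]]]]; have [v' _ h'] := concatA_r wvp h.
by exists u, w, v'.
Qed.

Lemma subpath_concatr q p1 p2 p :
  is_concat p1 p2 p -> subpath q p2 -> subpath q p.
Proof.
move=> h [u [w [v [uqw wvp]]]]; have [w' h1 h2] := concatA_l wvp h.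
by have [u' _ h4] := concatA_l uqw h1; exists u', w', v.
Qed.

(** * Coefficients of the comultiplication *)

Lemma mcoeff_path_comulE x p q :
  (path_comul x)@_(p, q) = \sum_(r <- msupp x) x@_r *+ ((p, q) \in splits r).
Proof.
rewrite /path_comul raddf_sum; apply: eq_bigr => r _; rewrite /= mcoeffZ.
rewrite -mulr_natr; congr (_ * _).
rewrite raddf_sum -(count_uniq_mem _ (splits_uniq r)) -sum1_count natr_sum.
by rewrite [RHS]big_mkcond; apply: eq_bigr => z _;
  rewrite /= mcoeffU; case: eqP.
Qed.

Lemma mcoeff_path_comul x p q r :
  is_concat p q r -> (path_comul x)@_(p, q) = x@_r.
Proof.
move=> pqr; rewrite mcoeff_path_comulE -[RHS]mulr1 -(sum_msupp x r (fun=> 1)).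
apply: eq_bigr => s _; rewrite mulr1; congr (_ *+ nat_of_bool _).
apply/splitsP/eqP => [pqs|->//]; exact: is_concat_inj pqs pqr.
Qed.

Lemma path_comul_neq0 x p q : (path_comul x)@_(p, q) != 0 ->
  exists2 r, is_concat p q r & x@_r != 0.
Proof.
move=> x0; have [[r pqr]|npq] := classic (exists r, is_concat p q r).
  by exists r; rewrite -?(mcoeff_path_comul x pqr).
move: x0; rewrite mcoeff_path_comulE big1 ?eqxx // => r _.
by case: splitsP => // pqr; case: npq; exists r.
Qed.

(** * Supports of subcoalgebras *)

Section Subcoalgebra.
Variable D : C -> Prop.
Hypothesis coD : subcoalgebra (@path_comul k G) D.
Local Notation P := (path_support D).

(** The slice at [p] of the comultiplication of [d] lies in [D], and its coefficient at [q] is that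
    of [d] at [r]. *)
Lemma support_concatr p q r : is_concat p q r -> P r -> P q.
Proof.
case: coD => sD dD pqr [d Dd dr].
have [b Db bE] := tens_sub_slicel p sD (dD d Dd).
by exists b; rewrite // bE (mcoeff_path_comul d pqr).
Qed.

Lemma support_concatl p q r : is_concat p q r -> P r -> P p.
Proof.
case: coD => sD dD pqr [d Dd dr].
have [b Db bE] := tens_sub_slicer q sD (dD d Dd).
by exists b; rewrite // bE (mcoeff_path_comul d pqr).
Qed.

(** A concatenation contains [q] as soon as one of its two parts does, so the comultiplication of
    [x] has no term with [q] in either factor. *)
Lemma subcoalgebra_avoiding q :
  subcoalgebra (@path_comul k G) (vanishing_on D (subpath q)).
Proof.
case: coD => sD dD; split; first exact: subspace_vanishing_on.
move=> x [Dx x0]; apply: tens_sub_vanishing => //; first exact: dD.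
move=> p r pr; apply/eqP/negPn/negP => /path_comul_neq0[w prw].
by rewrite x0 ?eqxx //; case: pr;
  [exact: subpath_concatl prw|exact: subpath_concatr prw].
Qed.

End Subcoalgebra.

(** * Primality and the construction of cycles *)

Section Prime.
Variable D : C -> Prop.
Hypothesis primeD : prime_subcoalgebra (@path_comul k G) D.
Local Notation P := (path_support D).
Let coD : subcoalgebra (@path_comul k G) D := proj1 primeD.

Lemma not_avoiding q : P q -> ~ same D (vanishing_on D (subpath q)).
Proof.
move=> [d Dd dq] /(_ d)[/(_ Dd)[_ d0] _].
by rewrite d0 ?eqxx // in dq; apply: subpath_refl.
Qed.

(* The elements of [D] whose paths avoid [q] form a proper subcoalgebra, and so
   for [q']; by primality their wedge is proper, so some comultiplication has a
   term [p1 ⊗ p2] with [q] inside [p1] and [q'] inside [p2]. *)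
Lemma prime_connect q q' : P q -> P q' ->
  exists m r t, [/\ is_concat q m r, is_concat r q' t & P t].
Proof.
move=> Pq Pq'; apply: NNPP => noqq'.
have sub_v T : sub (vanishing_on D T) D by move=> x [].
have [sD dD] := coD.
case: (proj2 primeD _ _ (subcoalgebra_avoiding coD q) (sub_v _)
  (subcoalgebra_avoiding coD q') (sub_v _)); last 2 first.
- exact: not_avoiding.
- exact: not_avoiding.
move=> x; split=> [Dx|[]//]; split=> //.
have [|z1 [z2 [h1 h2 ->]]] :=
  @tens_sub_split _ _ D D (subpath q) (subpath q') _ sD sD (dD x Dx).
  move=> p1 p2 [u [w [v [uqw wvp1]]]] [u' [w' [v' [uqw' wvp2]]]].
  apply/eqP/negPn/negP => /path_comul_neq0[p pE xp]; apply: noqq'.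
  have Pp : P p by exists x.
  (* Here [p] is u q v u' q' v'; cutting off [u] and [v'] leaves [q m q'] with [m] = v u'. *)
  have [y qvy uyp1] := concatA_r uqw wvp1.
  have [z yp2z uzp] := concatA_r uyp1 pE.
  have [f ywf fvz] := concatA_l wvp2 yp2z.
  have [g yug gqf] := concatA_l uqw' ywf.
  have [m vum qmg] := concatA_r qvy yug.
  exists m, g, f; split=> //; apply: (support_concatl coD fvz).
  exact: (support_concatr coD uzp).
by exists z2, z1; split; rewrite // addrC.
Qed.

(** If every support path through [q] were trivial, joining [q] to an arbitrary [r] in the support
    would make [r] the vertex of [q], and [D] would be the line on it. *)
Lemma nontrivial_extension q : P q ->
  (forall a, ~ same D (@vertex_line k G a)) ->
  exists2 s, P s & (0 < plen s)%N /\ subpath q s.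
Proof.
move=> Pq nline; apply: NNPP => nos.
have short s : P s -> subpath q s -> plen s = 0%N.
  by move=> Ps qs; apply/eqP/negPn; rewrite -lt0n; apply/negP => s0;
    apply: nos; exists s.
have plen0 s : plen s = 0%N -> s = ptriv (psrc s).
  by move=> /size0nil s0; apply: gpath_inj.
have onlyq r : P r -> r = ptriv (psrc q).
  move=> Pr; have [m [s [t [qms srt Pt]]]] := prime_connect Pq Pr.
  have qs : subpath q s := subpath_concatl qms (subpath_refl q).
  have := short _ Pt (subpath_concatl srt qs).
  case: (srt) => sr _; case: (qms) => qm _.
  rewrite /plen => -> ->; rewrite !size_cat => /eqP.
  rewrite !addn_eq0 -!andbA => /and3P[/eqP q0 /eqP m0 /eqP r0].
  rewrite (plen0 r) // -sr (concat_tgt qms) (plen0 m) // -qm.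
  by rewrite /ptgt (size0nil q0).
have [[D0 D1] _] := coD; have [d Dd dq] := Pq.
have Dline x : D x -> x = x@_(ptriv (psrc q)) *: << ptriv (psrc q) >>.
  move=> Dx; apply/malgP => r; rewrite mcoeffZ mcoeffU.
  have [<-|nr] := eqVneq; first by rewrite mulr1.
  rewrite mulr0; apply/eqP/negPn/negP => xr; case/eqP: nr.
  by rewrite -(onlyq r) //; exists x.
apply: (nline (psrc q)) => x; split=> [/Dline ->|[c ->]]; first by eexists.
rewrite (onlyq q Pq) in dq.
have -> : c *: << ptriv (psrc q) >> = (c / d@_(ptriv (psrc q))) *: d :> C.
  by rewrite [X in _ = _ *: X](Dline _ Dd) scalerA divfK.
by rewrite -[_ *: d]addr0; apply: D1.
Qed.

(** As [is_concats] nests to the right, a prefix [w] can be absorbed into the first factor. *)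
Lemma concats_prepend p1 p r ps w : is_concats p1 ps p ->
  is_concat w p r -> exists2 p1', is_concat w p1 p1' & is_concats p1' ps r.
Proof.
case: ps => [->|p2 ps /= [s [hs p1s]] wpr]; first by exists r.
by have [p1' h1 h2] := concatA_l p1s wpr; exists p1' => //; exists s.
Qed.

(** With [s] = u q v, [r] is u q (v m c): the piece v m merges into the first block of [c], and the
    [q] of [s] adds one occurrence. *)
Lemma precS q n s m sm c r : subpath q s -> is_concat s m sm ->
  is_concat sm c r -> prec q n c -> prec q n.+1 r.
Proof.
move=> [u [w [v [uqw wvs]]]] smE scr [p1 [ps h]].
have [x smx wxsm] := concatA_r wvs smE.
have [y xcy wyr] := concatA_r wxsm scr.
have [z qyz uzr] := concatA_r uqw wyr.
have [p1' _ h'] := concats_prepend h xcy.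
by exists u, [tuple of p1' :: ps], z; split=> //; exists y.
Qed.

(* [c] is a cycle because [c s] is again a path starting where [s] starts;
   keeping the trailing [s] is what lets the next step prepend [s m]. *)
Lemma cycle_power q s n : P s -> (0 < plen s)%N -> subpath q s ->
  exists c r, [/\ is_concat c s r, P r, psrc c = psrc s, prec q n c
    & (n <= plen c)%N].
Proof.
move=> Ps s0 qs; elim: n => [|n [c [r [csr Pr cs qc nc]]]].
  (* For [n = 0] a trivial path serves; it becomes a cycle only once a copy of [s] is prepended. *)
  exists (ptriv (psrc s)), s; split=> //.
  by exists (ptriv (psrc s)), [tuple].
have [m [sm [t [smE tE Pt]]]] := prime_connect Ps Pr.
(* The path [t] = s m (c s) is regrouped as (s m c) s, so [c'] is s m c. *)
have [c' cE c'E] := concatA_l csr tE.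
exists c', t; split=> //; first by rewrite (concat_src cE) (concat_src smE).
  exact: precS qs smE cE qc.
case: cE smE => _ _ + [_ _]; rewrite /plen => -> ->.
rewrite !size_cat -add1n leq_add //; exact: leq_trans (leq_addr _ _).
Qed.

End Prime.

End PrimePathSubcoalgebras.

Theorem theorem3p1 (k : fieldType) (G : quiver)
  (D : {malg k[gpath G]} -> Prop)
  (hD : prime_subcoalgebra (@path_comul k G) D)
  (hD1 : forall a : vertex G, ~ same D (@vertex_line k G a))
  (q : gpath G) (hq : path_support D q) (n : nat) (hn : (0 < n)%N) :
  exists c : gpath G, [/\ path_support D c, is_cycle c & prec q n c].
Proof.
have [s Ps [s0 qs]] := nontrivial_extension hD hq hD1.
have [c [r [csr Pr cs qc nc]]] := cycle_power hD n Ps s0 qs.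
exists c; split=> //; first exact: (support_concatl (proj1 hD) csr).
split; first exact: leq_trans nc.
by rewrite cs (concat_match csr).
Qed.
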